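(* Let $B>0$ be a constant, $n\geq3$ a natural number, $C\leq\frac{(n-2)^2}{12B}$ a constant, and set $$r_0=\sqrt{\frac{n-2+\sqrt{(n-2)^2-12BC}}{6B}},\qquad A=\frac{1-2n+\sqrt{(n-2)^2-12BC}}{3}\,r_0^4,\qquad f(r)=\sqrt{1+\frac{C}{r^2}+\frac{A}{r^4}+Br^2}\quad(r\geq r_0).$$ Then there does not exist a smooth function $v(r)$ such that the metric $$\tilde g=-v^2dt^2+f^{-2}dr^2+r^2\big(\sigma_1^2+\sigma_2^2+f^2\sigma_3^2\big)$$ satisfies the 5-dimensional vacuum Einstein equations with negative cosmological constant $\Lambda$, $$\tilde R_{ij}=\tfrac23\Lambda\,\tilde g_{ij},\qquad 0\leq i,j\leq4 .$$
   Context: $\theta,\phi,\psi$ are Euler angles, with $0\leq\theta\leq\pi$, $0\leq\phi\leq2\pi$, $0\leq\psi\leq\frac{4\pi}{n}$ (so they parametrize $S^3/\mathbb{Z}_n$), and $$\sigma_1=\tfrac12(\sin\psi\,d\theta-\sin\theta\cos\psi\,d\phi),\quad \sigma_2=\tfrac12(-\cos\psi\,d\theta-\sin\theta\sin\psi\,d\phi),\quad \sigma_3=\tfrac12(d\psi+\cos\theta\,d\phi),$$ which satisfy $d\sigma_1=2\sigma_2\wedge\sigma_3$, $d\sigma_2=2\sigma_3\wedge\sigma_1$, $d\sigma_3=2\sigma_1\wedge\sigma_2$. $\tilde R_{ij}$ is the Ricci tensor of $\tilde g$. The function $v$ depends only on $r$, with $r\geq r_0$; that $\tilde g$ is a (Lorentzian)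 metric means in particular that $v$ does not vanish. *)

(* Defs.v *)
From HB Require Import structures.
From mathcomp Require Export all_boot all_order all_algebra.
From mathcomp Require Export all_classical all_reals all_analysis.
Export Order.TTheory GRing.Theory Num.Theory.
Export numFieldNormedType.Exports.

Set Implicit Arguments.
Unset Strict Implicit.
Unset Printing Implicit Defensive.

Local Open Scope classical_set_scope.
Local Open Scope ring_scope.

Section Curvature.
Context {R : realType} {d : nat}.
Implicit Types (G : 'rV[R]_d -> 'M[R]_d) (x : 'rV[R]_d) (i j k l : 'I_d).

Definition partial i (F : 'rV[R]_d -> R) x : R := 'D_(delta_mx 0 i) F x.

(* Gamma^k_ij = 1/2 g^kl (d_i g_jl + d_j g_il - d_l g_ij) *)
Definition christoffel G k i j x : R :=
  2^-1 * \sum_l invmx (G x) k l *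
    (partial i (fun y => G y j l) x + partial j (fun y => G y i l) x
     - partial l (fun y => G y i j) x).

(* R_ij = d_k Gamma^k_ij - d_j Gamma^k_ik
          + Gamma^k_kl Gamma^l_ij - Gamma^k_jl Gamma^l_ik,
   the sign convention for which round spheres have positive Ricci tensor. *)
Definition ricci G i j x : R :=
  \sum_k (partial k (christoffel G k i j) x - partial j (christoffel G k i k) x)
  + \sum_k \sum_l
      (christoffel G k k l x * christoffel G l i j x
       - christoffel G k j l x * christoffel G l i k x).

End Curvature.

(* C^oo on the closed half-line [a, +oo[ : v is the restriction of a function
   that is C^oo on the whole line.  By Borel's theorem this is the same as
   having one-sided derivatives of all orders at a. *)
Definition smooth_from {R : realType} (a : R) (v : R -> R) : Prop :=
  exists w : R -> R,
    (forall (k : nat) (s : R), derivable (derive1n k w) s 1) /\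
    (forall s : R, a <= s -> v s = w s).

(* Coordinates (t, r, theta, phi, psi). *)
Definition ct : 'I_5 := @Ordinal 5 0 isT.
Definition cr : 'I_5 := @Ordinal 5 1 isT.
Definition cth : 'I_5 := @Ordinal 5 2 isT.
Definition cph : 'I_5 := @Ordinal 5 3 isT.
Definition cps : 'I_5 := @Ordinal 5 4 isT.

Section Metric.
Context {R : realType}.
Implicit Types (x : 'rV[R]_5).

(* A 1-form at a point is the row of its components in the coordinate basis. *)
Definition dx (i : 'I_5) : 'rV[R]_5 := delta_mx 0 i.

(* The symmetric square a^2 = a (x) a of a 1-form, as a bilinear form. *)
Definition sq (a : 'rV[R]_5) : 'M[R]_5 := a^T *m a.

Definition sigma1 x : 'rV[R]_5 :=
  2^-1 *: (sin (x 0 cps) *: dx cth - (sin (x 0 cth) * cos (x 0 cps)) *: dx cph).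

Definition sigma2 x : 'rV[R]_5 :=
  2^-1 *: (- cos (x 0 cps) *: dx cth
           - (sin (x 0 cth) * sin (x 0 cps)) *: dx cph).

Definition sigma3 x : 'rV[R]_5 :=
  2^-1 *: (dx cps + cos (x 0 cth) *: dx cph).

Definition gtilde (v f : R -> R) x : 'M[R]_5 :=
  let r := x 0 cr in
  - (v r) ^+ 2 *: sq (dx ct) + (f r) ^- 2 *: sq (dx cr)
  + r ^+ 2 *: (sq (sigma1 x) + sq (sigma2 x) + (f r) ^+ 2 *: sq (sigma3 x)).

(* The open coordinate chart.  Its boundary is excluded because the coordinate
   expression degenerates there: f r0 = 0, and sin theta = 0 on the axes. *)
Definition chart (r0 : R) (n : nat) : set 'rV[R]_5 :=
  [set x | [/\ r0 < x 0 cr,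
               0 < x 0 cth < pi,
               0 < x 0 cph < 2 * pi &
               0 < x 0 cps < 4 * pi / n%:R]].

Definition einstein (L : R) (U : set 'rV[R]_5) (G : 'rV[R]_5 -> 'M[R]_5) : Prop :=
  forall x, U x -> forall i j : 'I_5, ricci G i j x = 2 / 3 * L * G x i j.

End Metric.

(* Main.v *)
Require Import Defs.
From mathcomp Require Import ring lra.

(** The metric [gtilde v f] is invariant under time translations and under the
    rotations of the squashed sphere, so in the coordinates (t, r, theta, phi,
    psi) its components, its Christoffel symbols and its Ricci tensor are
    functions of r and theta alone.  Writing F = f^2, four diagonal components
    of the Einstein equations R_ij = L g_ij, L = 2/3 Lambda, carry the whole
    argument.

    The spatial metric is Kaehler, with a complex structure that exchanges the
    unit vector fields dual to dr / f and r f sigma_3.  Its Ricci tensor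
    therefore takes equal values on these two fields, and so does the Hessian
    of v divided by v.  This is the equation v'' = v' / r, whose solutions are
    v = a r^2 + b ([lapse_quadratic]).

    Along sigma_1 and sigma_2 the spatial Ricci curvature is - 6 B - 2 C / r^4,
    and the Einstein equation multiplied by r^4 v becomes a cubic polynomial
    identity in r^2.  Its coefficients of degree 1 and 0 are - 4 a C and
    - 2 (b C + a A).  If a != 0 they give A = C = 0.  If a = 0 then v is
    constant, and the time component reads L v = 0, which is excluded
    ([static_vacuum_profile]).

    Finally A = C = 0 is incompatible with the choice of r0.  With rho = r0^2,
    the polynomial r^4 F(r) = B r^6 + r^4 + C r^2 + A vanishes at r^2 = rho,
    so A = C = 0 would give B rho^3 + rho^2 = 0 with B and rho positive.  Its
    derivative with respect to r^2 at rho is n rho > 0, which also makes F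
    positive beyond r0, so that the metric is nondegenerate on the chart. *)

Set Implicit Arguments.
Unset Strict Implicit.
Unset Printing Implicit Defensive.

Local Open Scope classical_set_scope.
Local Open Scope ring_scope.

(** * Symbolic differentiation on the real line *)

Section PointwiseDerivatives.
Context {R : realType}.
Implicit Types (f g : R -> R) (x a b : R).

Lemma is_derive1D f g x a b : is_derive x 1 f a -> is_derive x 1 g b ->
  is_derive x 1 (fun s => f s + g s) (a + b).
Proof. by move=> ? ?; exact: is_deriveD. Qed.

Lemma is_derive1N f x a : is_derive x 1 f a ->
  is_derive x 1 (fun s => - f s) (- a).
Proof. by move=> ?; exact: is_deriveN. Qed.

Lemma is_derive1M f g x a b : is_derive x 1 f a -> is_derive x 1 g b ->
  is_derive x 1 (fun s => f s * g s) (a * g x + f x * b).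
Proof.
move=> fa gb; apply: (is_derive_eq (is_deriveM fa gb)).
by rewrite addrC [a * _]mulrC.
Qed.

Lemma is_derive1X f n x a : is_derive x 1 f a ->
  is_derive x 1 (fun s => f s ^+ n) (n%:R * f x ^+ n.-1 * a).
Proof.
move=> fa; have -> : (fun s => f s ^+ n) = f ^+ n by rewrite exprfctE.
exact: is_deriveX.
Qed.

Lemma is_derive1V f x a : f x != 0 -> is_derive x 1 f a ->
  is_derive x 1 (fun s => (f s)^-1) (- f x ^- 2 * a).
Proof. by move=> fx0 fa; exact: is_deriveV. Qed.

Lemma is_derive1_id x : is_derive x 1 (fun s : R => s) 1.
Proof. exact: is_derive_id. Qed.

Lemma is_derive1_cst b x : is_derive x 1 (fun _ : R => b) 0.
Proof. exact: is_derive_cst. Qed.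

Lemma is_derive1_inv x : x != 0 -> is_derive x 1 (@GRing.inv R) (- x ^- 2).
Proof.
move=> x0; apply: (is_derive_eq (is_derive1V x0 (is_derive1_id x))).
by rewrite mulr1.
Qed.

Lemma is_derive1_mull b x : is_derive x 1 ( *%R b) b.
Proof.
apply: (is_derive_eq (is_derive1M (is_derive1_cst b x) (is_derive1_id x))).
by rewrite mul0r add0r mulr1.
Qed.

End PointwiseDerivatives.

(** Class resolution is switched off in the calls to [refine]: left to itself
    it picks the instances stated for functions as ring elements, and leaves
    derivatives built with scalings and unfolded powers, which [field] does
    not recognize.  The last branch is for functions that unification has
    eta-reduced. *)
Ltac derive_tac :=
  match goal with
  | |- is_derive _ _ (fun _ => ?b) _ => exact: is_derive1_cst
  | |- is_derive _ _ (fun s => s) _ => exact: is_derive1_id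
  | |- is_derive _ _ (fun s => _ + _) _ =>
      notypeclasses refine (is_derive1D _ _); derive_tac
  | |- is_derive _ _ (fun s => - _) _ =>
      notypeclasses refine (is_derive1N _); derive_tac
  | |- is_derive _ _ (fun s => _ * _) _ =>
      notypeclasses refine (is_derive1M _ _); derive_tac
  | |- is_derive _ _ (fun s => _ ^+ ?n) _ =>
      notypeclasses refine (is_derive1X n _); derive_tac
  | |- is_derive _ _ (fun s => (_)^-1) _ =>
      notypeclasses refine (is_derive1V _ _); [ by [] | derive_tac ]
  | |- _ => first [ eassumption | exact: is_derive_sin | exact: is_derive_cos
                  | by apply: is_derive1_inv | exact: is_derive1_mull ]
  end.

Ltac derive_eval :=
  match goal with
  | |- context [derive ?f ?x ?v] =>
    let H := fresh in
    eassert (H : is_derive x v f _) by derive_tac;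
    rewrite (@derive_val _ _ _ _ _ _ _ H) {H}
  end.

(** * Curvature of metrics depending on r and theta only *)

Section TwoVariableMetrics.
Context {R : realType}.
Implicit Types (phi : R -> R -> R) (x y : 'rV[R]_5) (U : set 'rV[R]_5).

(** Partial derivative, along the coordinate of index [i] among (t, r, theta,
    phi, psi), of a function of r and theta. *)
Definition pd (i : nat) phi (r th : R) : R :=
  match i with
  | 1 => 'D_1 (phi^~ th) r
  | 2 => 'D_1 (phi r) th
  | _ => 0
  end.

(** Near [x] both sides are limits of the same difference quotient. *)
Lemma partial_pd U (F : 'rV[R]_5 -> R) phi i x : open U -> U x ->
  (forall y, U y -> F y = phi (y 0 cr) (y 0 cth)) ->
  partial i F x = pd i phi (x 0 cr) (x 0 cth).
Proof.
move=> oU Ux FE; rewrite /partial.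
rewrite (@near_eq_derive _ _ _ F (fun y => phi (y 0 cr) (y 0 cth))); last first.
  by apply: filterS (open_nbhs_nbhs (conj oU Ux)) => y /FE.
rewrite /derive /=.
have shiftE h (k : 'I_5) :
    (h *: delta_mx 0 i + x) 0 k = h * (k == i)%:R + x 0 k.
  by rewrite !mxE eqxx.
under eq_fun do rewrite !shiftE.
case: i {shiftE} => [[|[|[|[|[|//]]]]] Hi] /=; rewrite ?(mulr0, add0r).
- by under eq_fun do rewrite !mulr0 !add0r subrr scaler0; exact: lim_cst.
- by rewrite /derive /=; under eq_fun do rewrite mulr0 add0r.
- by rewrite /derive /=; under eq_fun do rewrite mulr0 add0r.
- by under eq_fun do rewrite !mulr0 !add0r subrr scaler0; exact: lim_cst.
- by under eq_fun do rewrite !mulr0 !add0r subrr scaler0; exact: lim_cst.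
Qed.

(** Tensor components are indexed by [nat] rather than ['I_5] so that tables
    of them reduce by pattern matching; the indices 0 to 4 stand for t, r,
    theta, phi, psi. *)
Definition entries := nat -> nat -> R -> R -> R.

Section Coordinates.
Variables (U : set 'rV[R]_5) (G : 'rV[R]_5 -> 'M[R]_5).
Variables (g h : entries) (Gam : nat -> entries).
Hypothesis oU : open U.
Hypothesis GE : forall x, U x ->
  G x = \matrix_(i < 5, j < 5) g i j (x 0 cr) (x 0 cth).
Hypothesis gh : forall x, U x -> forall i j : 'I_5,
  \sum_(k < 5) g i k (x 0 cr) (x 0 cth) * h k j (x 0 cr) (x 0 cth)
  = (i == j)%:R.
Hypothesis GamE : forall x, U x -> forall k i j : 'I_5,
  2^-1 * \sum_(l < 5) h k l (x 0 cr) (x 0 cth) *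
    (pd i (g j l) (x 0 cr) (x 0 cth) + pd j (g i l) (x 0 cr) (x 0 cth)
     - pd l (g i j) (x 0 cr) (x 0 cth)) = Gam k i j (x 0 cr) (x 0 cth).

Lemma invmx_coord x (k l : 'I_5) : U x ->
  invmx (G x) k l = h k l (x 0 cr) (x 0 cth).
Proof.
move=> Ux; pose H : 'M[R]_5 := \matrix_(k, l) h k l (x 0 cr) (x 0 cth).
have GH : G x *m H = 1%:M.
  apply/matrixP => i j; rewrite !mxE -(gh Ux); apply: eq_bigr => m _.
  by rewrite GE // !mxE.
have [Gu _] := mulmx1_unit GH.
by rewrite -[invmx _]mulmx1 -GH mulKmx // mxE.
Qed.

Lemma christoffel_coord x (k i j : 'I_5) : U x ->
  christoffel G k i j x = Gam k i j (x 0 cr) (x 0 cth).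
Proof.
move=> Ux; rewrite -GamE // /christoffel; congr (_ * _).
have pE p a b :
    partial p (fun y => G y a b) x = pd p (g a b) (x 0 cr) (x 0 cth).
  by apply: (partial_pd _ oU Ux) => y Uy; rewrite GE // mxE.
by apply: eq_bigr => l _; rewrite !pE invmx_coord.
Qed.

Lemma ricci_coord x (i j : 'I_5) : U x ->
  ricci G i j x =
  \sum_(k < 5) (pd k (Gam k i j) (x 0 cr) (x 0 cth)
                - pd j (Gam k i k) (x 0 cr) (x 0 cth))
  + \sum_(k < 5) \sum_(l < 5)
     (Gam k k l (x 0 cr) (x 0 cth) * Gam l i j (x 0 cr) (x 0 cth)
      - Gam k j l (x 0 cr) (x 0 cth) * Gam l i k (x 0 cr) (x 0 cth)).
Proof.
move=> Ux; rewrite /ricci.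
have pE p k a b : partial p (christoffel G k a b) x =
    pd p (Gam k a b) (x 0 cr) (x 0 cth).
  by apply: (partial_pd _ oU Ux) => y; exact: christoffel_coord.
congr (_ + _); first by apply: eq_bigr => k _; rewrite !pE.
by apply: eq_bigr => k _; apply: eq_bigr => l _; rewrite !christoffel_coord.
Qed.

End Coordinates.
End TwoVariableMetrics.

(** * The squashed-sphere metric *)

Section Biaxial.
Context {R : realType}.

Definition biaxial (V F : R -> R) (i j : nat) (r th : R) : R :=
  match i, j with
  | 0, 0 => - V r ^+ 2
  | 1, 1 => (F r)^-1
  | 2, 2 => r ^+ 2 / 4
  | 3, 3 => r ^+ 2 / 4 * (sin th ^+ 2 + F r * cos th ^+ 2)
  | 3, 4 | 4, 3 => r ^+ 2 / 4 * (F r * cos th)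
  | 4, 4 => r ^+ 2 / 4 * F r
  | _, _ => 0
  end.

(** Only the squares of [v] and [f] occur, so the square root in [f] is never
    differentiated; the angle psi drops out because
    sigma_1^2 + sigma_2^2 = (dtheta^2 + sin^2 theta dphi^2) / 4. *)
Lemma gtilde_biaxial (v f V F : R -> R) (x : 'rV[R]_5) :
  v (x 0 cr) = V (x 0 cr) -> f (x 0 cr) ^+ 2 = F (x 0 cr) ->
  gtilde v f x = \matrix_(i < 5, j < 5) biaxial V F i j (x 0 cr) (x 0 cth).
Proof.
move=> vV fF; apply/matrixP=> i j; rewrite /gtilde vV fF.
have sc := cos2sin2 (x 0 cps).
case: i j => [[|[|[|[|[|//]]]]] Hi] [[|[|[|[|[|//]]]]] Hj];
  rewrite /sigma1 /sigma2 /sigma3 /sq /dx !mxE !big_ord1 !mxE /= -?val_eqE /=;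
  rewrite ?mulr0; first [by ring: sc | by field: sc].
Qed.

Definition biaxial_inv (V F : R -> R) (i j : nat) (r th : R) : R :=
  match i, j with
  | 0, 0 => - V r ^- 2
  | 1, 1 => F r
  | 2, 2 => 4 / r ^+ 2
  | 3, 3 => 4 / (r ^+ 2 * sin th ^+ 2)
  | 3, 4 | 4, 3 => - (4 * cos th / (r ^+ 2 * sin th ^+ 2))
  | 4, 4 => 4 / r ^+ 2 * ((F r)^-1 + cos th ^+ 2 / sin th ^+ 2)
  | _, _ => 0
  end.

Variables (V V1 V2 F F1 F2 : R -> R).

Definition biaxial_pd (p i j : nat) (r th : R) : R :=
  match p, i, j with
  | 1, 0, 0 => - (2 * V r * V1 r)
  | 1, 1, 1 => - (F1 r / F r ^+ 2)
  | 1, 2, 2 => r / 2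
  | 1, 3, 3 => r / 2 * (sin th ^+ 2 + F r * cos th ^+ 2)
               + r ^+ 2 / 4 * (F1 r * cos th ^+ 2)
  | 1, 3, 4 | 1, 4, 3 => (r / 2 * F r + r ^+ 2 / 4 * F1 r) * cos th
  | 1, 4, 4 => r / 2 * F r + r ^+ 2 / 4 * F1 r
  | 2, 3, 3 => r ^+ 2 / 2 * (1 - F r) * sin th * cos th
  | 2, 3, 4 | 2, 4, 3 => - (r ^+ 2 / 4 * F r * sin th)
  | _, _, _ => 0
  end.

(** Christoffel symbols, the upper index first. *)
Definition biaxial_Gam (k i j : nat) (r th : R) : R :=
  match k, i, j with
  | 0, 0, 1 | 0, 1, 0 => V1 r / V r
  | 1, 0, 0 => F r * V r * V1 r
  | 1, 1, 1 => - (F1 r / (2 * F r))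
  | 1, 2, 2 => - (F r * r / 4)
  | 1, 3, 3 => - (F r / 2) * (r / 2 * (sin th ^+ 2 + F r * cos th ^+ 2)
                              + r ^+ 2 / 4 * (F1 r * cos th ^+ 2))
  | 1, 3, 4 | 1, 4, 3 =>
      - (F r / 2) * cos th * (r / 2 * F r + r ^+ 2 / 4 * F1 r)
  | 1, 4, 4 => - (F r / 2) * (r / 2 * F r + r ^+ 2 / 4 * F1 r)
  | 2, 1, 2 | 2, 2, 1 => r^-1
  | 2, 3, 3 => - ((1 - F r) * sin th * cos th)
  | 2, 3, 4 | 2, 4, 3 => F r * sin th / 2
  | 3, 1, 3 | 3, 3, 1 => r^-1
  | 3, 2, 3 | 3, 3, 2 => cos th / sin th * (1 - F r / 2)
  | 3, 2, 4 | 3, 4, 2 => - (F r / (2 * sin th))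
  | 4, 1, 3 | 4, 3, 1 => cos th * F1 r / (2 * F r)
  | 4, 1, 4 | 4, 4, 1 => r^-1 + F1 r / (2 * F r)
  | 4, 2, 3 | 4, 3, 2 =>
      - (cos th ^+ 2 / sin th * (1 - F r / 2)) - sin th / 2
  | 4, 2, 4 | 4, 4, 2 => F r * cos th / (2 * sin th)
  | _, _, _ => 0
  end.

Definition biaxial_ricci (i j : nat) (r th : R) : R :=
  let Gam := biaxial_Gam in
  \sum_(k < 5) (pd k (Gam k i j) r th - pd j (Gam k i k) r th)
  + \sum_(k < 5) \sum_(l < 5)
     (Gam k k l r th * Gam l i j r th - Gam k j l r th * Gam l i k r th).

Section AtPoint.
Variables (r th : R).
Hypotheses (r0 : r != 0) (s0 : sin th != 0) (V0 : V r != 0) (F0 : F r != 0).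
Hypotheses (dV : is_derive r 1 V (V1 r)) (dF : is_derive r 1 F (F1 r)).

Lemma biaxial_invP (i j : 'I_5) :
  \sum_(k < 5) biaxial V F i k r th * biaxial_inv V F k j r th = (i == j)%:R.
Proof.
rewrite !big_ord_recl big_ord0.
case: i j => [[|[|[|[|[|//]]]]] Hi] [[|[|[|[|[|//]]]]] Hj];
  rewrite /biaxial /biaxial_inv /= -?val_eqE /=
          ?(mulr0, mul0r, addr0, add0r, mulr1n, mulr0n) //;
  by field; rewrite ?r0 ?s0 ?V0 ?F0.
Qed.

Lemma biaxial_pdP (p i j : 'I_5) :
  pd p (biaxial V F i j) r th = biaxial_pd p i j r th.
Proof.
case: p i j => [[|[|[|[|[|//]]]]] Hp] [[|[|[|[|[|//]]]]] Hi]
  [[|[|[|[|[|//]]]]] Hj];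
rewrite /pd /biaxial_pd /= /biaxial //; derive_eval; rewrite /=;
by field; rewrite ?F0.
Qed.

Lemma biaxial_GamP (k i j : 'I_5) :
  2^-1 * \sum_(l < 5) biaxial_inv V F k l r th *
    (pd i (biaxial V F j l) r th + pd j (biaxial V F i l) r th
     - pd l (biaxial V F i j) r th) = biaxial_Gam k i j r th.
Proof.
under eq_bigr do rewrite !biaxial_pdP.
rewrite !big_ord_recl big_ord0.
case: k i j => [[|[|[|[|[|//]]]]] Hk] [[|[|[|[|[|//]]]]] Hi]
  [[|[|[|[|[|//]]]]] Hj];
rewrite /biaxial_inv /biaxial_Gam /biaxial_pd /=
        ?(mul0r, mulr0, addr0, subr0, add0r) //.
all: by field; rewrite ?r0 ?s0 ?V0 ?F0.
Qed.

Hypotheses (dV1 : is_derive r 1 V1 (V2 r)) (dF1 : is_derive r 1 F1 (F2 r)).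

(* The denominators of the Christoffel symbols, in the form in which the
   differentiation tactic looks for them. *)
Let F20 : 2 * F r != 0. Proof. by rewrite mulf_neq0 // pnatr_eq0. Qed.
Let s20 : 2 * sin th != 0. Proof. by rewrite mulf_neq0 // pnatr_eq0. Qed.

Ltac expand_ricci :=
  rewrite /biaxial_ricci !big_ord_recl !big_ord0 /pd /biaxial_Gam /=;
  do ?derive_eval; rewrite /=.

Lemma biaxial_ricci_tt : biaxial_ricci 0 0 r th =
  V r * (F r * V2 r + F1 r * V1 r + 3 * F r * V1 r / r).
Proof. by expand_ricci; field; rewrite r0 s0 V0 F0. Qed.

(** In an orthonormal frame, the parts of this component and of the psi psi
    component that come from the spatial metric are the same expression in F:
    this reflects the Kaehler property, which holds for every profile F. *)
Lemma biaxial_ricci_rr : biaxial_ricci 1 1 r th =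
  - (F2 r / 2 + 5 * F1 r / (2 * r)) / F r
  - (V2 r + F1 r * V1 r / (2 * F r)) / V r.
Proof. by expand_ricci; field; rewrite r0 s0 V0 F0. Qed.

Lemma biaxial_ricci_psps : biaxial_ricci 4 4 r th =
  r ^+ 2 * F r / 4 * (- (F2 r / 2 + 5 * F1 r / (2 * r))
     - F r * V1 r / V r * (r^-1 + F1 r / (2 * F r))).
Proof. by expand_ricci; field; rewrite r0 s0 V0 F0. Qed.

Lemma biaxial_ricci_thth : biaxial_ricci 2 2 r th =
  r ^+ 2 / 4 * (4 * (1 - F r) / r ^+ 2 - F1 r / r - F r * V1 r / (r * V r)).
Proof. by expand_ricci; field: (cos2sin2 th); rewrite r0 s0 V0 F0. Qed.

End AtPoint.
End Biaxial.

(** * The Einstein equations as equations in r *)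

Section RadialEquations.
Context {R : realType}.

Definition ray_chart (r0 : R) : set 'rV[R]_5 :=
  [set x | r0 < x 0 cr /\ 0 < x 0 cth < pi].

Lemma open_ray_chart (r0 : R) : open (ray_chart r0).
Proof.
have cc k : continuous (fun x : 'rV[R]_5 => x 0 k) by exact: coord_continuous.
rewrite /ray_chart [X in open X](_ : _ =
   ((fun x : 'rV[R]_5 => x 0 cr) @^-1` [set s | r0 < s])
   `&` (((fun x : 'rV[R]_5 => x 0 cth) @^-1` [set s | 0 < s])
   `&` ((fun x : 'rV[R]_5 => x 0 cth) @^-1` [set s | s < pi]))); last first.
  by apply/seteqP; split=> x /= [? /andP[]].
apply: openI; first by apply: open_comp => [x _|]; [exact: cc|exact: open_gt].
by apply: openI; apply: open_comp => [x _|];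
  [exact: cc|exact: open_gt|exact: cc|exact: open_lt].
Qed.

Definition chart_point (r : R) (n : nat) : 'rV[R]_5 :=
  \row_(i < 5) nth 0 [:: 0; r; pi / 2; pi; 2 * pi / n%:R] i.

Lemma chart_chart_point (r0 r : R) n : (0 < n)%N -> r0 < r ->
  chart r0 n (chart_point r n).
Proof.
move=> n0 rr; have p0 := pi_gt0 R.
have n0' : 0 < n%:R^-1 :> R by rewrite invr_gt0 ltr0n.
rewrite /chart /= !mxE /=; split=> //.
- by apply/andP; split; lra.
- by apply/andP; split; lra.
- by apply/andP; split; nra.
Qed.

Section Equations.
Variables (v f V V1 V2 F F1 F2 : R -> R) (r0 Lambda : R) (n : nat).
Hypothesis r0_ge0 : 0 <= r0.
Hypothesis vV : forall r, r0 < r -> v r = V r.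
Hypothesis fF : forall r, r0 < r -> f r ^+ 2 = F r.
Hypothesis V0 : forall r, r0 < r -> V r != 0.
Hypothesis F0 : forall r, r0 < r -> F r != 0.
Hypothesis dV : forall r, r0 < r -> is_derive r 1 V (V1 r).
Hypothesis dV1 : forall r, r0 < r -> is_derive r 1 V1 (V2 r).
Hypothesis dF : forall r, r0 < r -> is_derive r 1 F (F1 r).
Hypothesis dF1 : forall r, r0 < r -> is_derive r 1 F1 (F2 r).

Lemma ricci_gtilde x (i j : 'I_5) : ray_chart r0 x ->
  ricci (gtilde v f) i j x
  = biaxial_ricci V V1 F F1 i j (x 0 cr) (x 0 cth).
Proof.
have nz y : ray_chart r0 y -> y 0 cr != 0 /\ sin (y 0 cth) != 0.
  move=> [ry thy]; split; first by rewrite gt_eqF // (le_lt_trans r0_ge0).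
  by rewrite gt_eqF // sin_gt0_pi.
apply: (ricci_coord (g := biaxial V F) (h := biaxial_inv V F)
          (open_ray_chart (r0 := r0))) => y Uy.
- by have [ry _] := Uy; apply: gtilde_biaxial; [exact: vV|exact: fF].
- by have [? ?] := nz _ Uy; have [ry _] := Uy => a b; apply: biaxial_invP; auto.
- have [? ?] := nz _ Uy; have [ry _] := Uy => k a b.
  by apply: biaxial_GamP; auto.
Qed.

Hypothesis n_gt0 : (0 < n)%N.
Hypothesis ein : einstein Lambda (chart r0 n) (gtilde v f).

(** The first equation compares the rr and the psi psi components, in which
    the second derivative of F cancels. *)
Lemma einstein_radial r : r0 < r ->
  [/\ V2 r = V1 r / r,
      4 * (1 - F r) / r ^+ 2 - F1 r / r - F r * V1 r / (r * V r) = 2 / 3 * Lambda &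
      F r * V2 r + F1 r * V1 r + 3 * F r * V1 r / r = - (2 / 3 * Lambda) * V r].
Proof.
move=> rr; have [x xc xr] : exists2 x, chart r0 n x & x 0 cr = r.
  by exists (chart_point r n); [exact: chart_chart_point | rewrite mxE].
have xray : ray_chart r0 x by case: xc.
have s0 : sin (x 0 cth) != 0.
  by rewrite gt_eqF // sin_gt0_pi //; case: xray.
have rn0 : r != 0 by rewrite gt_eqF // (le_lt_trans r0_ge0).
have [Vr Fr] := (V0 rr, F0 rr).
have [[dVr dV1r] [dFr dF1r]] := ((dV rr, dV1 rr), (dF rr, dF1 rr)).
have E (i : 'I_5) : biaxial_ricci V V1 F F1 i i r (x 0 cth)
    = 2 / 3 * Lambda * biaxial V F i i r (x 0 cth) :> R.
  move: (ein xc i i); rewrite ricci_gtilde // xr => ->.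
  by rewrite (gtilde_biaxial (V := V) (F := F)) ?xr ?vV ?fF // mxE.
have := E ct; rewrite (biaxial_ricci_tt rn0 s0 Vr Fr dVr dFr dV1r) /= => tt.
have := E cr.
rewrite (biaxial_ricci_rr rn0 s0 Vr Fr dVr dFr dV1r dF1r) /= => rrE.
have := E cth; rewrite (biaxial_ricci_thth _ rn0 s0 Vr Fr dFr) /= => th.
have := E cps; rewrite (biaxial_ricci_psps _ rn0 s0 Vr Fr dFr dF1r) /= => ps.
split.
- apply/eqP; rewrite -subr_eq0; apply/eqP.
  transitivity (- (V r / F r) *
    (F r * (- (F2 r / 2 + 5 * F1 r / (2 * r)) / F r
            - (V2 r + F1 r * V1 r / (2 * F r)) / V r)
     - 4 / (r ^+ 2 * F r) *
       (r ^+ 2 * F r / 4 * (- (F2 r / 2 + 5 * F1 r / (2 * r))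
          - F r * V1 r / V r * (r^-1 + F1 r / (2 * F r)))))).
    by field; rewrite rn0 Vr Fr.
  by rewrite rrE ps; field; rewrite rn0 Fr.
- have r2 : r ^+ 2 / 4 != 0 by rewrite mulf_neq0 ?expf_neq0 ?invr_eq0 ?pnatr_eq0.
  by apply: (mulfI r2); rewrite th mulrC.
- by apply: (mulfI Vr); rewrite tt; ring.
Qed.

End Equations.
End RadialEquations.

(** * Solving the equations in r *)

Section RadialSolutions.
Context {R : realType}.

Lemma is_derive0_ray (f : R -> R) (r0 : R) :
  (forall r, r0 < r -> is_derive r 1 f 0) ->
  forall x y, r0 < x -> r0 < y -> f x = f y.
Proof.
move=> df; suff le x y : r0 < x -> x <= y -> f x = f y.
  by move=> x y x0 y0; have [/le->//|/ltW/le->] := leP x y.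
move=> x0 xy.
have [||c _ /eqP] := @MVT_segment R f (cst 0) x y xy.
- by move=> z /[!in_itv]/= /andP[xz _]; apply: df; exact: lt_trans xz.
- apply: derivable_within_continuous => z /[!in_itv]/= /andP[xz _].
  by case: (df z (lt_le_trans x0 xz)).
- by rewrite mul0r subr_eq0 => /eqP.
Qed.

(** The equation says that V' / r has zero derivative. *)
Lemma lapse_quadratic (V V1 V2 : R -> R) (r0 : R) : 0 <= r0 ->
  (forall r, r0 < r -> is_derive r 1 V (V1 r)) ->
  (forall r, r0 < r -> is_derive r 1 V1 (V2 r)) ->
  (forall r, r0 < r -> V2 r = V1 r / r) ->
  exists a b, forall r, r0 < r -> V r = a * r ^+ 2 + b /\ V1 r = 2 * a * r.
Proof.
move=> r00 dV dV1 ode.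
have n0 r : r0 < r -> r != 0 by move=> ?; rewrite gt_eqF // (le_lt_trans r00).
have r1 : r0 < r0 + 1 by rewrite ltrDl.
pose a := V1 (r0 + 1) / (r0 + 1) / 2.
have V1E r : r0 < r -> V1 r = 2 * a * r.
  move=> rr; have -> : 2 * a = V1 r / r; last by rewrite mulfVK // n0.
  transitivity (V1 (r0 + 1) / (r0 + 1)); first by rewrite /a; field; rewrite n0.
  apply: (@is_derive0_ray (fun s => V1 s / s) r0) => // s rs.
  have := dV1 _ rs; have s0 := n0 _ rs => dV1s.
  eassert (H : is_derive s 1 (fun s => V1 s / s) _) by derive_tac.
  by apply: (is_derive_eq H); rewrite ode //; field.
exists a, (V (r0 + 1) - a * (r0 + 1) ^+ 2) => r rr; split; last exact: V1E.
apply/eqP; rewrite addrC -subr_eq; apply/eqP.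
apply: (@is_derive0_ray (fun s => V s - a * s ^+ 2) r0) => // s rs.
have := dV _ rs => dVs.
eassert (H : is_derive s 1 (fun s => V s - a * s ^+ 2) _) by derive_tac.
by apply: (is_derive_eq H); rewrite V1E //=; ring.
Qed.

Lemma cubic_eq0_ray (c0 c1 c2 c3 x0 : R) :
  (forall x, x0 < x -> c3 * x ^+ 3 + c2 * x ^+ 2 + c1 * x + c0 = 0) ->
  [/\ c0 = 0, c1 = 0, c2 = 0 & c3 = 0].
Proof.
move=> p0.
have e k : (0 < k)%N -> c3 * (x0 + k%:R) ^+ 3 + c2 * (x0 + k%:R) ^+ 2
    + c1 * (x0 + k%:R) + c0 = 0.
  by move=> k0; apply: p0; rewrite ltrDl ltr0n.
have e1 := e 1%N isT; have e2 := e 2%N isT.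
have e3 := e 3%N isT; have e4 := e 4%N isT.
(* The third difference of the values at four consecutive points is 6 c3, and
   lower differences give the lower coefficients in turn. *)
have c30 : c3 = 0 by lra.
have c20 : c2 = 0 by move: e1 e2 e3; rewrite c30; lra.
have c10 : c1 = 0 by move: e1 e2; rewrite c30 c20; lra.
by split=> //; move: e1; rewrite c30 c20 c10; lra.
Qed.

Definition profile (A B C r : R) : R :=
  1 + C / r ^+ 2 + A / r ^+ 4 + B * r ^+ 2.

Definition profile1 (A B C r : R) : R :=
  - 2 * C / r ^+ 3 - 4 * A / r ^+ 5 + 2 * B * r.

Definition profile2 (A B C r : R) : R :=
  6 * C / r ^+ 4 + 20 * A / r ^+ 6 + 2 * B.

Lemma is_derive_profile (A B C r : R) : r != 0 ->
  is_derive r 1 (profile A B C) (profile1 A B C r).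
Proof.
move=> r0; have [r2 r4] : r ^+ 2 != 0 /\ r ^+ 4 != 0 by rewrite !expf_neq0.
rewrite /profile.
eassert (H : is_derive r 1
  (fun r => 1 + C / r ^+ 2 + A / r ^+ 4 + B * r ^+ 2) _) by derive_tac.
by apply: (is_derive_eq H); rewrite /profile1 /=; field.
Qed.

Lemma is_derive_profile1 (A B C r : R) : r != 0 ->
  is_derive r 1 (profile1 A B C) (profile2 A B C r).
Proof.
move=> r0; have [r3 r5] : r ^+ 3 != 0 /\ r ^+ 5 != 0 by rewrite !expf_neq0.
rewrite /profile1.
eassert (H : is_derive r 1
  (fun r => - 2 * C / r ^+ 3 - 4 * A / r ^+ 5 + 2 * B * r) _) by derive_tac.
by apply: (is_derive_eq H); rewrite /profile2 /=; field.
Qed.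

Lemma profile_gt0 (A B C rho r : R) : 0 < B -> 0 < rho ->
  A = - (B * rho ^+ 3 + rho ^+ 2 + C * rho) ->
  0 < 3 * B * rho ^+ 2 + 2 * rho + C -> rho < r ^+ 2 ->
  0 < profile A B C r.
Proof.
move=> B0 rho0 AE slope rr.
have r2 : 0 < r ^+ 2 by exact: lt_trans rr.
have rn0 : r != 0 by rewrite -sqrf_eq0 gt_eqF.
have d0 : 0 < r ^+ 2 - rho by rewrite subr_gt0.
(* Taylor expansion at rho of the cubic r^4 F as a polynomial in r^2. *)
have -> : profile A B C r =
  ((3 * B * rho ^+ 2 + 2 * rho + C) * (r ^+ 2 - rho)
   + (3 * B * rho + 1) * (r ^+ 2 - rho) ^+ 2 + B * (r ^+ 2 - rho) ^+ 3)
  / (r ^+ 2) ^+ 2.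
  by rewrite /profile AE; field.
apply: divr_gt0; last exact: exprn_gt0.
apply: addr_gt0; last by rewrite mulr_gt0 // exprn_gt0.
apply: addr_gt0; first exact: mulr_gt0.
by rewrite mulr_gt0 ?exprn_gt0 // ltr_wpDl // ltW // !mulr_gt0.
Qed.

(** For V = a r^2 + b the second equation, multiplied by r^4 V, is a cubic
    polynomial identity in r^2; it leaves only A = C = 0 or a constant V. *)
Lemma static_vacuum_profile (A B C L r0 : R) (V V1 V2 : R -> R) :
  let F := profile A B C in
  let F1 := profile1 A B C in
  0 <= r0 -> L != 0 ->
  (forall r, r0 < r -> V r != 0) ->
  (forall r, r0 < r -> is_derive r 1 V (V1 r)) ->
  (forall r, r0 < r -> is_derive r 1 V1 (V2 r)) ->
  (forall r, r0 < r ->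
    [/\ V2 r = V1 r / r,
      4 * (1 - F r) / r ^+ 2 - F1 r / r - F r * V1 r / (r * V r) = L &
      F r * V2 r + F1 r * V1 r + 3 * F r * V1 r / r = - L * V r]) ->
  A = 0 /\ C = 0.
Proof.
move=> F F1 r00 L0 V0 dV dV1 eqs.
have [|a [b VE]] := lapse_quadratic r00 dV dV1; first by move=> r /eqs[].
have [e0 e1 _ _] : [/\ - 2 * C * b - 2 * a * A = 0, - 4 * C * a = 0,
     - (6 * B + L) * b - 2 * a = 0 & - (6 * B + L) * a - 2 * a * B = 0].
  apply: (@cubic_eq0_ray _ _ _ _ (r0 ^+ 2)) => x rx.
  have x0 : 0 < x by apply: le_lt_trans rx; exact: sqr_ge0.
  have rr : r0 < Num.sqrt x by rewrite -(ger0_norm r00) -sqrtr_sqr ltr_sqrt.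
  have [_ + _] := eqs _ rr; have := V0 _ rr; have [-> ->] := VE _ rr.
  have := sqr_sqrtr (ltW x0); rewrite /F /F1 /profile /profile1.
  have : 0 < Num.sqrt x by exact: le_lt_trans rr.
  move: (Num.sqrt x) => r r_gt0 <- V0r thr.
  have rn0 : r != 0 by rewrite gt_eqF.
  have polyE : (- (6 * B + L) * a - 2 * a * B) * (r ^+ 2) ^+ 3
      + (- (6 * B + L) * b - 2 * a) * (r ^+ 2) ^+ 2 + - 4 * C * a * r ^+ 2
      + (- 2 * C * b - 2 * a * A) =
    (4 * (1 - (1 + C / r ^+ 2 + A / r ^+ 4 + B * r ^+ 2)) / r ^+ 2
     - (- 2 * C / r ^+ 3 - 4 * A / r ^+ 5 + 2 * B * r) / r
     - (1 + C / r ^+ 2 + A / r ^+ 4 + B * r ^+ 2) * (2 * a * r)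
       / (r * (a * r ^+ 2 + b)) - L) * (r ^+ 4 * (a * r ^+ 2 + b)).
    by field; rewrite rn0 V0r.
  by rewrite polyE thr subrr mul0r.
have [a0|a0] := eqVneq a 0; last first.
  have C0 : C = 0.
    move/eqP: e1; rewrite mulf_eq0 (negbTE a0) orbF mulf_eq0 oppr_eq0.
    by rewrite pnatr_eq0 /= => /eqP.
  split=> //; move/eqP: e0; rewrite C0 mulr0 mul0r sub0r oppr_eq0 mulf_eq0.
  by rewrite mulf_eq0 pnatr_eq0 (negbTE a0) /= => /eqP.
(* A nonzero constant lapse violates the time component. *)
have r1 : r0 < r0 + 1 by rewrite ltrDl.
have [-> _] := eqs _ r1; have := V0 _ r1; have [-> V10] := VE _ r1.
rewrite V10 a0 !(mulr0, mul0r, add0r) => b0 /esym/eqP.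
by rewrite mulf_eq0 oppr_eq0 (negbTE L0) (negbTE b0).
Qed.

End RadialSolutions.

(** * Nonexistence *)

Theorem theorem3p2 (R : realType) (B C : R) (n : nat) :
  0 < B -> (3 <= n)%N -> C <= (n%:R - 2) ^+ 2 / (12 * B) ->
  let r0 : R :=
    Num.sqrt ((n%:R - 2 + Num.sqrt ((n%:R - 2) ^+ 2 - 12 * B * C)) / (6 * B)) in
  let A : R :=
    (1 - 2 * n%:R + Num.sqrt ((n%:R - 2) ^+ 2 - 12 * B * C)) / 3 * r0 ^+ 4 in
  let f : R -> R :=
    fun r => Num.sqrt (1 + C / r ^+ 2 + A / r ^+ 4 + B * r ^+ 2) in
  forall Lambda : R, Lambda < 0 ->
  ~ exists v : R -> R,
      [/\ smooth_from r0 v,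
          (forall r, r0 <= r -> v r != 0) &
          einstein Lambda (chart r0 n) (gtilde v f)].
Proof.
move=> B0 n3 hC r0 A f Lambda Lambda0 [v [[w [smooth_w vw]] v0 ein]].
have Bn0 : B != 0 by rewrite gt_eqF.
have nR : 3 <= n%:R :> R by rewrite ler_nat.
pose s : R := Num.sqrt ((n%:R - 2) ^+ 2 - 12 * B * C).
pose rho : R := (n%:R - 2 + s) / (6 * B).
have s_ge0 : 0 <= s by exact: sqrtr_ge0.
have s2 : s ^+ 2 = (n%:R - 2) ^+ 2 - 12 * B * C.
  rewrite sqr_sqrtr // subr_ge0 mulrC -ler_pdivlMr //.
  by rewrite mulr_gt0.
have rho0 : 0 < rho by rewrite divr_gt0 ?mulr_gt0 //; lra.
have r0E : r0 ^+ 2 = rho by exact: sqr_sqrtr (ltW rho0).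
have r0_ge0 : 0 <= r0 by exact: sqrtr_ge0.
(* n - 2 and s are the sum and the difference of 3 B rho and C / rho. *)
have CE : C = rho * (n%:R - 2 - s) / 2.
  have -> : C = ((n%:R - 2) ^+ 2 - s ^+ 2) / (12 * B) by rewrite s2; field.
  by rewrite /rho; field.
have sE : s = 6 * B * rho - (n%:R - 2) by rewrite /rho; field.
have AE : A = - (B * rho ^+ 3 + rho ^+ 2 + C * rho).
  by rewrite /A -/s (exprM r0 2 2) r0E CE sE; field.
have slope : 0 < 3 * B * rho ^+ 2 + 2 * rho + C.
  rewrite (_ : _ + C = n%:R * rho); first by rewrite mulr_gt0 //; lra.
  by rewrite CE sE; field.
have F_gt0 r : r0 < r -> 0 < profile A B C r.
  move=> rr; apply: (profile_gt0 B0 rho0 AE slope).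
  by rewrite -r0E ltr_pXn2r ?nnegrE // (le_trans r0_ge0) // ltW.
have rn0 r : r0 < r -> r != 0 by move=> ?; rewrite gt_eqF // (le_lt_trans r0_ge0).
have dw (k : nat) (r : R) : is_derive r 1 (derive1n k w) (derive1n k.+1 w r).
  by apply: DeriveDef; [exact: smooth_w | rewrite /= derive1E].
have w0 r : r0 < r -> w r != 0 by move=> rr; rewrite -vw ?v0 // ltW.
have [A0 C0] : A = 0 /\ C = 0; last first.
  have : 0 < B * rho ^+ 3 + rho ^+ 2.
    by apply: addr_gt0; [apply: mulr_gt0 => //|]; exact: exprn_gt0.
  move: AE; rewrite A0 C0 mul0r addr0 => /eqP.
  by rewrite eq_sym oppr_eq0 => /eqP->; rewrite ltxx.
apply: (@static_vacuum_profile _ A B C (2 / 3 * Lambda) r0 w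
          (derive1n 1 w) (derive1n 2 w)) => //.
- by rewrite lt_eqF // nmulr_llt0.
- by move=> r _; exact: (dw 0%N).
apply: (@einstein_radial _ v f w _ _ _ _ (profile2 A B C) _ _ n) => //.
- by move=> r rr; rewrite vw // ltW.
- by move=> r rr; rewrite sqr_sqrtr // ltW // F_gt0.
- by move=> r rr; rewrite gt_eqF // F_gt0.
- by move=> r _; exact: (dw 0%N).
- by move=> r /rn0; exact: is_derive_profile.
- by move=> r /rn0; exact: is_derive_profile1.
- exact: leq_trans n3.
Qed.
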